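(* Consider the online list s-batch problem with setup time $s=1$, unit processing times $p_i=1$ for all jobs, and objective the sum of completion times $\sum_i C_i$. Let $\mathcal{D}$ be the online algorithm which batches after exactly the jobs numbered $2, 5, 9, 13, 18, 23, 29, 35, 41, 48, 54, 61, 68, 76, 84, 91, 100, 108, 117, 126, 135, 145, 156, 167, 179, 192, 206, 221, 238, 257, 278, 302, 329, 361, 397, 439, 488, 545, 612, 690, 781, 888, 1013, 1159, 1329, 1528, 1760$, and $2000+40i$ for all integers $i\ge 0$. Then $\mathcal{D}$ is $\frac{619}{583}$-competitive, and no online algorithm for this problem has competitiveness smaller than $\frac{619}{583}$, i.e. for every real $C<\frac{619}{583}$ no online algorithm is $C$-competitive.
   Context: **The list s-batch problem.** Jobs $J_1,\dots,J_n$ with processing times $p_i\ge 0$ are to be scheduled on a single machine and partitioned into batches $\mathcal{B}_1,\dots,\mathcal{B}_r$, which are processed one after the other, without idle time, starting at time $0$. A feasible solution assigns each job $J_i$ to the $m_i$-th batch, where the given order of the jobs must be respected: $m_i\le m_j$ whenever $i<j$ (so each batch is a set of consecutive jobs, and batches are processed in list order). Each batch requires a setup time $s$ immediately before it is processed, and then takes time equal to the sum of the processing times of its jobs. The completion time $C_i$ of a job $J_i$ is the completion time of the batch containing it. The cost of a schedule is $\sum_{i=1}^n C_i$. Here $s=1$ and $p_i=1$ for all $i$, so an input is determined by the number $n$ of jobs. If the $n$ jobs are partitioned into $r$ nonempty consecutive batches ending at jobs $0=b_0<b_1<\dots<b_r=n$ (that is, batch $k$ consists of jobs $b_{k-1}+1,\dots,b_k$),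 then the cost is $\sum_{k=1}^{r}(b_k-b_{k-1})(b_k+k)$. The optimal cost $\mathrm{cost}_{\mathrm{opt}}$ for $n$ jobs is the minimum of this quantity over all such partitions. **Online algorithms.** An online algorithm must choose each $m_i$ before receiving $J_{i+1}$, and without knowing whether $J_i$ is the last job. The first job is in the first batch, and upon receiving $J_i$ ($i\ge 2$) the algorithm has only two choices: $m_i=m_{i-1}$ (add $J_i$ to the current batch) or $m_i=m_{i-1}+1$ (close the current batch and make $J_i$ the first job of a new batch). Algorithms are deterministic. Thus, for unit jobs, an online algorithm is given by a set $S$ of positive integers, fixed independently of $n$: the algorithm ''batches after job $i$'' for $i\in S$, meaning that job $i$ is the last job of its batch and, if there is a job $i+1$, it starts a new batch. On an input of $n$ jobs, the batches end exactly at the jobs in $(S\cap\{1,\dots,n\})\cup\{n\}$. **Competitiveness.** An online algorithm is $C$-competitive if, for every input sequence of jobs (here, for every $n$), the cost of its schedule is at most $C\cdot \mathrm{cost}_{\mathrm{opt}}$, where $\mathrm{cost}_{\mathrm{opt}}$ is the minimum cost of any schedule for that input sequence. *)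

(* Defs.v *)
From mathcomp Require Import all_boot all_order all_algebra.
From mathcomp Require Import reals.

Set Implicit Arguments.
Unset Strict Implicit.
Unset Printing Implicit Defensive.

Import Order.TTheory GRing.Theory Num.Theory.
Local Open Scope ring_scope.

(* Jobs and batches are numbered from 0: the ordinal i : 'I_n is the job       *)
(* J_(i+1), and m i = k means that this job is in the (k+1)-th batch.          *)

Section ListSBatch.
Variables (R : realType) (n : nat).
Implicit Types (s : R) (p : 'I_n -> R) (m : 'I_n -> nat).

(* The second conjunct says that the batches form a partition: no batch        *)
(* preceding a used one is empty.                                              *)
Definition feasible m : bool :=
  [forall i : 'I_n, forall j : 'I_n, (i <= j)%N ==> (m i <= m j)%N] &&
  [forall i : 'I_n, forall k : 'I_(m i), [exists j, m j == k]].

Definition batch_time s p m (k : nat) : R := s + \sum_(j | m j == k) p j.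

Definition completion_time s p m (i : 'I_n) : R :=
  \sum_(k < (m i).+1) batch_time s p m k.

Definition cost s p m : R := \sum_i completion_time s p m i.

(* As batches are nonempty, batch numbers are < n, so it is enough to minimise *)
(* over the finite type {ffun 'I_n -> 'I_n}; see opt_cost_le and               *)
(* opt_cost_attained. The default value is the cost of a single batch.         *)
Definition opt_cost s p : R :=
  \big[Num.min/cost s p (fun=> 0%N)]_(m : {ffun 'I_n -> 'I_n}
     | feasible (fun i => m i)) cost s p (fun i => m i).

End ListSBatch.

(* For unit jobs, a deterministic online algorithm is the set S of the         *)
(* (1-based) numbers of the jobs after which it closes the current batch. The  *)
(* jobs received before the job i : 'I_n are those numbered 1, ..., i, so S 0  *)
(* is irrelevant.                                                              *)
Definition online_algorithm := pred nat.

Definition online_schedule (S : online_algorithm) (n : nat) (i : 'I_n) : nat :=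
  count S (iota 1 i).

Definition competitive (R : realType) (C : R) (S : online_algorithm) : Prop :=
  forall n : nat,
    cost 1 (fun=> 1) (@online_schedule S n) <= C * @opt_cost R n 1 (fun=> 1).

Definition algD : online_algorithm := fun i =>
  (i \in [:: 2; 5; 9; 13; 18; 23; 29; 35; 41; 48; 54; 61; 68; 76; 84; 91; 100;
             108; 117; 126; 135; 145; 156; 167; 179; 192; 206; 221; 238; 257;
             278; 302; 329; 361; 397; 439; 488; 545; 612; 690; 781; 888; 1013;
             1159; 1329; 1528; 1760])%N
  || ((2000 <= i) && (40 %| i - 2000))%N.

Section Facts.
Variables (R : realType) (n : nat).
Implicit Types (s : R) (p : 'I_n -> R) (m : 'I_n -> nat).

Lemma feasibleP m :
  reflect ((forall i j : 'I_n, (i <= j)%N -> (m i <= m j)%N) /\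
           (forall (i : 'I_n) k, (k < m i)%N -> exists j, m j = k))
          (feasible m).
Proof.
apply: (iffP andP) => -[mono part]; split.
- by move=> i j; move/forallP/(_ i)/forallP/(_ j)/implyP: mono; apply.
- move=> i k ki; move/forallP/(_ i)/forallP/(_ (Ordinal ki)): part.
  by move=> /existsP[j /eqP]; exists j.
- by apply/forallP => i; apply/forallP => j; apply/implyP; apply: mono.
- apply/forallP => i; apply/forallP => k; apply/existsP.
  by have [j mj] := part i k (ltn_ord k); exists j; apply/eqP.
Qed.

Lemma feasible_lt m : feasible m -> forall i, (m i < n)%N.
Proof.
move=> /feasibleP[_ part] i.
have /fin_all_exists[f fK] : forall k : 'I_(m i).+1, exists j, m j = k.
  move=> k; have := ltn_ord k; rewrite ltnS leq_eqVlt => /orP[/eqP->|].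
    by exists i.
  exact: part.
suff /leq_card : injective f by rewrite !card_ord.
by move=> k l fkl; apply: val_inj; rewrite /= -!fK fkl.
Qed.

Lemma eq_cost s p m m' : m =1 m' -> cost s p m = cost s p m'.
Proof.
move=> mm'; apply: eq_bigr => i _; rewrite /completion_time mm'.
by apply: eq_bigr => k _; congr (_ + _); apply: eq_bigl => j; rewrite mm'.
Qed.

Lemma opt_cost_le s p m : feasible m -> opt_cost s p <= cost s p m.
Proof.
move=> fm; pose f := [ffun i => Ordinal (feasible_lt fm i)].
have fE : (fun i => f i : nat) =1 m by move=> i; rewrite ffunE.
rewrite -(eq_cost s p fE) /opt_cost.
rewrite (bigD1 f) /=; first by rewrite ge_min lexx.
apply/feasibleP; have /feasibleP[mono part] := fm.
split=> [i j|i k]; rewrite !ffunE /=; first exact: mono.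
by move=> /part[j mj]; exists j; rewrite ffunE.
Qed.

Lemma opt_cost_attained s p :
  exists2 m, feasible m & opt_cost s p = cost s p m.
Proof.
rewrite /opt_cost; elim/big_ind: _ => [|x y|f ff].
- by exists (fun=> 0%N) => //; apply/feasibleP.
- by case: (leP x y).
- by exists (fun i => f i : nat).
Qed.

Lemma online_schedule_feasible (S : online_algorithm) :
  feasible (@online_schedule S n).
Proof.
apply/feasibleP; split=> [i j ij|i k]; rewrite /online_schedule.
  by rewrite -(subnKC ij) iotaD count_cat leq_addr.
case: i => i /=; elim: i => // i IHi lt_in.
rewrite -[in iota 1 _](addn1 i) iotaD count_cat /= addn0 => lt_k.
have lt_in' := ltnW lt_in.
have [|le_k] := ltnP k (count S (iota 1 i)); first exact: IHi.
exists (Ordinal lt_in') => /=; apply/eqP; rewrite eqn_leq le_k /=.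
rewrite -ltnS (leq_trans lt_k) // -[leqRHS]addn1 leq_add2l; exact: leq_b1.
Qed.

End Facts.

(* Main.v *)
(* Charge to a job the delays it causes to the earlier jobs of its batch: the
   u-th job of the k-th batch then costs i + u + k if i jobs precede it, so the
   cost is n(n-1)/2 plus the sum of the "slots" u + k. The pairs (u, k) are
   distinct and t - 1 of them have slot t, hence for every c the optimum is at
   least n(n-1)/2 + cn - C(c,3).
   For n < 2000 this bound, with the best c, is compared with the cost of D by
   computation; for n >= 2000 the fixed value c = 64 is good enough, and the
   inequality is between polynomials in the number of batches of size 40 and the
   size of the last batch.
   For the lower bound, an online algorithm of ratio below 619/583 would have to
   survive on the inputs of 1, 2, ..., 100 jobs. Its future costs depend only on
   the start and the number of the open batch and on the cost of the closed
   ones, and increase with the last two; an exhaustive search over the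
   undominated states finds that none survives n = 100. *)
From Stdlib Require Import NArith.
Require Import Defs.
From mathcomp Require Import all_boot all_order all_algebra.
From mathcomp Require Import reals.
From mathcomp Require Import zify ring lra.

Set Implicit Arguments.
Unset Strict Implicit.
Unset Printing Implicit Defensive.

Import Order.TTheory GRing.Theory Num.Theory.
Local Open Scope ring_scope.

(** * Slots and the lower bound on the optimum *)

Section Slots.
Variables (n : nat) (m : 'I_n -> nat).

Definition earlier (i : 'I_n) : nat :=
  (\sum_(j < n) ((j < i)%N && (m j == m i)))%N.

Definition slot (i : 'I_n) : nat := ((m i).+1 + (earlier i).+1)%N.

Lemma earlier_ltn (i j : 'I_n) :
  (i < j)%N -> m i = m j -> (earlier i < earlier j)%N.
Proof.
move=> ij mij; rewrite /earlier (bigD1 i) //= [ltnRHS](bigD1 i) //=.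
rewrite ltnn ij mij eqxx add0n add1n ltnS; apply: leq_sum => k _.
by case: (ltnP (k : nat) i) => // ki; rewrite (ltn_trans ki ij).
Qed.

Lemma slot_inj (i j : 'I_n) : m i = m j -> earlier i = earlier j -> i = j.
Proof.
move=> mij eij; apply/val_inj; case: (ltngtP (i : nat) j) => // ij.
  by have := earlier_ltn ij mij; rewrite eij ltnn.
by have := earlier_ltn ij (esym mij); rewrite eij ltnn.
Qed.

Lemma costE (R : realType) : feasible m ->
  cost 1 (fun=> 1) m = (\sum_(i < n) (i + slot i))%N%:R :> R.
Proof.
move=> /feasibleP[mono _].
have ctE (i : 'I_n) : completion_time 1 (fun=> 1) m i
    = ((m i).+1 + \sum_(j < n) (m j <= m i))%N%:R :> R.
  rewrite /completion_time /batch_time big_split /= sumr_const card_ord natrD.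
  congr (_ + _); rewrite natr_sum (exchange_big_dep predT) //=.
  apply: eq_bigr => j _; case: leqP => mji.
    by rewrite (big_pred1 (Ordinal (mji : m j < (m i).+1)%N)).
  by rewrite big1 // => k /eqP mjk; have := ltn_ord k; lia.
rewrite /cost (eq_bigr _ (fun i _ => ctE i)) -natr_sum; congr (_%:R).
(* By monotonicity, the jobs in batches up to that of [i] are those numbered at most [i] and the
   later ones of its own batch. Exchanging sums then charges each such delay to the later job. *)
transitivity (\sum_(i < n) ((m i).+1 +
    (\sum_(j < n) (j <= i) + \sum_(j < n) ((i < j)%N && (m j == m i)))))%N.
  apply: eq_bigr => i _; congr addn; rewrite -big_split /=.
  apply: eq_bigr => j _; case: (leqP (j : nat) i) => ij; first by rewrite mono.
  by have := mono i j (ltnW ij); lia.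
transitivity (\sum_(i < n) (i.+1 + ((m i).+1 + earlier i)))%N; last first.
  by apply: eq_bigr => i _; rewrite /slot; lia.
rewrite !big_split /= [in LHS]addnCA; congr addn; last congr addn.
  apply: eq_bigr => i _.
  rewrite -(big_mkord predT (fun j => (j <= i : nat)%N)) /=.
  rewrite (@big_cat_nat _ _ _ i.+1) //= (eq_big_nat _ _ (F2 := fun=> 1%N)).
    rewrite sum_nat_const_nat big_nat big1 => [|j]; lia.
  by move=> j; lia.
rewrite exchange_big; apply: eq_bigr => i _; apply: eq_bigr => j _.
by rewrite eq_sym.
Qed.

(** Row [x] sums to ['C(c - x.+1, 2)]; the rows add up by the hockey-stick identity. *)
Lemma sum_slots (c : nat) :
  (\sum_(x < c) \sum_(y < c) (c - (x.+1 + y.+1)) = 'C(c, 3))%N.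
Proof.
transitivity (\sum_(x < c) 'C(rev_ord x, 2))%N.
  apply: eq_bigr => x _; have xc := ltn_ord x; rewrite -bin2_sum /=.
  rewrite -(big_mkord predT (fun y => c - (x.+1 + y.+1))%N) /=.
  rewrite (@big_cat_nat _ _ _ (c - x.+1)) //=; last by lia.
  rewrite [X in (_ + X)%N]big_nat [X in (_ + X)%N]big1 ?addn0; last first.
    by move=> y; lia.
  rewrite big_nat_rev /=; apply: eq_big_nat => y; lia.
rewrite (reindex_inj rev_ord_inj) (eq_bigr (fun x : 'I_c => 'C(x, 2)));
  last by move=> x _; rewrite rev_ordK.
by elim: c => [|c IHc]; rewrite ?big_ord0 // big_ord_recr /= IHc binS addnC.
Qed.

(* Distinct jobs have distinct pairs [(m i, earlier i)], so the left-hand side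
   of [sum_slots] bounds the sum of [c - slot i] (truncated) over all jobs. *)
Lemma leq_sum_slot (c : nat) : (c * n <= \sum_i slot i + 'C(c, 3))%N.
Proof.
have le_c : (\sum_(i < n) (c - slot i) <= 'C(c, 3))%N.
  rewrite -sum_slots.
  pose here (i : 'I_n) (x y : 'I_c) := (m i == x) && (earlier i == y).
  apply: (@leq_trans (\sum_(i < n) \sum_(x < c) \sum_(y < c)
                        here i x y * (c - (x.+1 + y.+1))))%N.
    apply: leq_sum => i _; have [c_le|lt_c] := leqP c (slot i).
      by rewrite (eqP c_le).
    have xP : (m i < c)%N by move: lt_c; rewrite /slot; lia.
    have yP : (earlier i < c)%N by move: lt_c; rewrite /slot; lia.
    rewrite (bigD1 (Ordinal xP)) //= (bigD1 (Ordinal yP)) //=.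
    by rewrite /here !eqxx mul1n -addnA leq_addr.
  rewrite exchange_big /=; apply: leq_sum => x _.
  rewrite exchange_big /=; apply: leq_sum => y _.
  rewrite -big_distrl /= -[leqRHS]mul1n leq_mul2r; apply/orP; right.
  case: (boolP [exists i, here i x y]) => [/existsP[i hi]|/existsPn none];
    last by rewrite big1 // => i _; rewrite (negPf (none i)).
  rewrite (bigD1 i) //= hi big1 // => j ji; apply/eqP; rewrite eqb0.
  apply: contra ji; move: hi => /andP[/eqP mi /eqP ei] /andP[/eqP mj /eqP ej].
  by apply/eqP/slot_inj; rewrite ?mi ?ei.
have : (\sum_(i < n) c <= \sum_(i < n) slot i + \sum_(i < n) (c - slot i))%N.
  by rewrite -big_split /=; apply: leq_sum => i _; lia.
by rewrite sum_nat_const card_ord mulnC => /leq_trans; apply; rewrite leq_add2l.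
Qed.

End Slots.

Lemma opt_cost_ge (R : realType) (n c : nat) :
  ('C(n, 2) + c * n)%N%:R - 'C(c, 3)%:R <= @opt_cost R n 1 (fun=> 1).
Proof.
have [m fm ->] := @opt_cost_attained R n 1 (fun=> 1).
rewrite costE // lerBlDr -natrD ler_nat big_split /=.
by rewrite -bin2_sum big_mkord -addnA leq_add2l leq_sum_slot.
Qed.

(** * Simulation of online algorithms in binary arithmetic *)

Section Simulation.
Local Open Scope N_scope.

(* The first [jobs] jobs are scheduled, the first [closed] of them in [batches]
   batches of total cost [paid]; [current_cost] also counts the open batch. *)
Record state := State {jobs : N; closed : N; batches : N; paid : N}.

Definition current_cost (st : state) : N :=
  let: State n b k f := st in f + (n - b) * (n + k + 1).

Definition next (close : bool) (st : state) : state :=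
  let: State n b k f := st in
  let n' := n + 1 in
  if close then State n' n' (k + 1) (current_cost (State n' b k f))
  else State n' b k f.

Definition step (T : N -> bool) (st : state) := next (T (jobs st + 1)) st.

Definition run (T : N -> bool) (n : nat) := iter n (step T) (State 0 0 0 0).

End Simulation.

Section Run.
Variables (A : online_algorithm) (T : N -> bool).
Hypothesis TE : forall i : nat, (0 < i)%N -> T (N.of_nat i) = A i.

Let M i := count A (iota 1 i).

Lemma countA_recr i : M i.+1 = (M i + A i.+1)%N.
Proof. by rewrite /M -{1}[i.+1]addn1 iotaD count_cat /= addn0 add1n. Qed.

Lemma leq_countA i j : (i <= j)%N -> (M i <= M j)%N.
Proof. by move=> /subnKC <-; rewrite /M iotaD count_cat leq_addr. Qed.

(** A new job delays the [n - b] jobs of the open batch by 1 and itself completes at [n + k + 2];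
    the total increase [n + (k + 1) + (n - b + 1)] is exactly its term in the slot sum. *)
Lemma runP (n : nat) : exists b k f : nat,
  [/\ run T n = State (N.of_nat n) (N.of_nat b) (N.of_nat k) (N.of_nat f),
      (b <= n)%N, k = M n, (n - b = \sum_(j < n) (M j == M n))%N &
      (\sum_(i < n) (i + ((M i).+1 + (\sum_(j < i) (M j == M i)).+1))
         = f + (n - b) * (n + k + 1))%N].
Proof.
elim: n => [|n [b [k [f [runE bn kE bE fE]]]]].
  by exists 0%N, 0%N, 0%N; split; rewrite ?big_ord0.
have step_cost :
    (\sum_(i < n.+1) (i + ((M i).+1 + (\sum_(j < i) (M j == M i)).+1))
    = f + (n.+1 - b) * (n.+1 + k + 1))%N.
  rewrite big_ord_recr /= fE -bE -kE subSn //; ring.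
have -> : run T n.+1 = step T (run T n) by [].
rewrite runE /step /jobs.
have -> : (N.of_nat n + 1)%num = N.of_nat n.+1 by lia.
rewrite TE // step_cost big_ord_recr /= countA_recr.
case: (A n.+1) => /=.
  exists n.+1, k.+1, (f + (n.+1 - b) * (n.+1 + k + 1))%N; split=> //.
  - congr State; lia.
  - by rewrite kE addn1.
  - rewrite subnn big1 => [|j _]; first by lia.
    apply/eqP; rewrite eqb0 neq_ltn addn1 ltnS leq_countA //.
    exact/ltnW/ltn_ord.
  - by rewrite subnn addn0.
exists b, k, f; rewrite addn0 eqxx -bE subSn // leqW //.
by split=> //; [congr State; lia | rewrite addn1].
Qed.

Lemma cost_run (R : realType) (n : nat) :
  cost 1 (fun=> 1) (@online_schedule A n)
    = (N.to_nat (current_cost (run T n)))%:R :> R.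
Proof.
rewrite costE ?online_schedule_feasible //; congr (_%:R).
have [b [k [f [-> bn kE bE fE]]]] := runP n.
transitivity (f + (n - b) * (n + k + 1))%N; last by rewrite /=; lia.
rewrite -fE; apply: eq_bigr => i _; rewrite /slot /earlier /online_schedule.
congr (_ + (_ + _.+1))%N.
rewrite (big_ord_widen n (fun j => M j == M i : nat) (ltnW (ltn_ord i))).
by rewrite [RHS]big_mkcond; apply: eq_bigr => j _; case: ltnP.
Qed.

End Run.

(** * Lower bound by exhaustive search over undominated states *)

Section LowerBound.
Local Open Scope N_scope.

Definition dominates (x y : state) : bool :=
  [&& jobs x =? jobs y, closed x =? closed y,
      batches x <=? batches y & paid x <=? paid y].

Lemma dominates_trans : transitive dominates.
Proof.
by move=> [n b k f] [n' b' k' f'] [n'' b'' k'' f'']; rewrite /dominates /=; lia.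
Qed.

Lemma dominates_cost x y :
  dominates x y -> current_cost x <= current_cost y.
Proof.
move: x y => [n b k f] [n' b' k' f'] /and4P[/= /N.eqb_spec-> /N.eqb_spec->].
move=> /N.leb_spec0 le_k /N.leb_spec0 le_f.
by apply: N.add_le_mono => //; apply: N.mul_le_mono_l; lia.
Qed.

Lemma dominates_next close x y :
  dominates x y -> dominates (next close x) (next close y).
Proof.
have next_false : dominates x y -> dominates (next false x) (next false y).
  by move: x y => [n b k f] [n' b' k' f']; rewrite /dominates /=; lia.
move=> /next_false; case: close => // xy; have := dominates_cost xy.
move: x y xy {next_false} => [n b k f] [n' b' k' f'] /and4P[/= jobsE _ le_k _].
by move=> /N.leb_spec0 le_cost; rewrite /dominates /= jobsE le_cost; lia.
Qed.

Definition covered (front : seq state) (st : state) : bool :=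
  has (dominates^~ st) front.

(** A state is compared only with survivors after it in the list, so some dominated states may
    remain; this affects speed, not soundness. *)
Definition prune (front : seq state) : seq state :=
  foldr (fun st acc => if covered acc st then acc else st :: acc) [::] front.

Lemma covered_dominates front x y :
  dominates x y -> covered front x -> covered front y.
Proof. by move=> xy; apply: sub_has => z /dominates_trans; apply. Qed.

Lemma covered_prune front st : covered front st -> covered (prune front) st.
Proof.
elim: front => //= x front IH /orP[x_st|/IH st_front]; case: ifP => //=.
- by move=> /(covered_dominates x_st).
- by rewrite x_st.
- by rewrite st_front orbT.
Qed.

Definition viable (bound : N) (st : state) : bool :=
  583 * current_cost st <? 619 * bound.

Definition extend (bound : N) (front : seq state) : seq state :=
  prune (filter (viable bound)
    (map (next true) front ++ map (next false) front)).

Lemma dominates_viable bound x y :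
  dominates x y -> viable bound y -> viable bound x.
Proof. by move=> /dominates_cost; rewrite /viable; lia. Qed.

(** A dominating state can copy the decision taken from [st], and stays viable since its cost is no
    larger. *)
Lemma covered_extend bound front close st :
  covered front st -> viable bound (next close st) ->
  covered (extend bound front) (next close st).
Proof.
move=> front_st st_viable; apply: covered_prune.
rewrite /covered filter_cat has_cat; apply/orP.
have : has (dominates^~ (next close st))
    (filter (viable bound) (map (next close) front)).
  elim: front front_st => //= x front IH.
  move=> /orP[/(dominates_next close) x_st|/IH st_front].
    by rewrite (dominates_viable x_st) //= x_st.
  by case: ifP; rewrite //= st_front orbT.
by move: close {st_viable} => [] ?; [left | right].
Qed.

(* The [c] with [(c - 1)(c - 2) <= 2 n <= c (c - 1)], the best one in
   [opt_cost_ge]. *)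
Definition threshold (n : N) : N := (N.sqrt (8 * n) + 3) / 2.

(* Equality in [opt_cost_ge] is reached by batches of sizes [c - 2, c - 3, ...],
   of which the first [extra] ones are enlarged by one job. *)
Definition opt_batches (n : N) : N -> bool :=
  let c := threshold n in
  let extra := n - (c - 1) * (c - 2) / 2 in
  let ends := [seq k * (c - 1) - k * (k + 1) / 2 + N.min k extra
              | k <- map N.of_nat (iota 1 (N.to_nat (c - 1)))] in
  fun i => has (N.eqb i) ends.

(** The cost of an actual schedule, hence an upper bound on the optimum: the direction that makes
    [viable] a necessary condition. *)
Definition opt_bound (n : nat) : N :=
  current_cost (run (opt_batches (N.of_nat n)) n).

Fixpoint frontier (n : nat) : seq state :=
  if n is n'.+1 then extend (opt_bound n) (frontier n')
  else [:: State 0 0 0 0].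

Lemma frontier_100 : frontier 100 = [::].
Proof. by vm_compute. Qed.
End LowerBound.

Lemma opt_bound_ge (R : realType) (n : nat) :
  @opt_cost R n 1 (fun=> 1) <= (N.to_nat (opt_bound n))%:R.
Proof.
have := @cost_run (fun i => opt_batches (N.of_nat n) (N.of_nat i))
  (opt_batches (N.of_nat n)) (fun i _ => erefl) R n.
by move=> <-; apply/opt_cost_le/online_schedule_feasible.
Qed.

Lemma opt_cost_gt0 (R : realType) (n : nat) :
  (0 < n)%N -> 0 < @opt_cost R n 1 (fun=> 1).
Proof.
(* For [c = 2] the subtracted binomial vanishes. *)
move=> n_gt0; apply: lt_le_trans (opt_cost_ge R n 2).
by rewrite subr0 ltr0n addn_gt0 muln_gt0 n_gt0 orbT.
Qed.

Lemma not_competitive (R : realType) (C : R) (A : online_algorithm) :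
  C < 619 / 583 -> ~ competitive C A.
Proof.
move=> ltC compA.
pose T (i : N) := A (N.to_nat i).
have TE (i : nat) : (0 < i)%N -> T (N.of_nat i) = A i.
  by rewrite /T Nnat.Nat2N.id.
(* Each prefix is a complete input, so viability is forced after every job; it is strict because the
   optimum is positive. *)
have run_viable n : viable (opt_bound n.+1) (run T n.+1).
  have := compA n.+1; rewrite (cost_run TE) => le_cost.
  have opt_gt0 := @opt_cost_gt0 R n.+1 isT.
  have opt_le := opt_bound_ge R n.+1.
  set x := current_cost _ in le_cost; set y := opt_bound _ in opt_le.
  have : (583 * N.to_nat x)%N%:R < (619 * N.to_nat y)%N%:R :> R.
    rewrite !natrM.
    have lt_opt : C * @opt_cost R n.+1 1 (fun=> 1)
        < 619 / 583 * @opt_cost R n.+1 1 (fun=> 1) by rewrite ltr_pM2r.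
    lra.
  by rewrite ltr_nat /viable -/x -/y; lia.
have run_covered n : covered (frontier n) (run T n).
  by elim: n => //= n IH; apply: covered_extend => //; apply: run_viable.
by have := run_covered 100%N; rewrite frontier_100.
Qed.

(** * Competitiveness of [algD]: computation below 2000, polynomials beyond *)

Section UpperBound.
Local Open Scope N_scope.

Definition breaks : seq N :=
  [:: 2; 5; 9; 13; 18; 23; 29; 35; 41; 48; 54; 61; 68; 76; 84; 91; 100;
      108; 117; 126; 135; 145; 156; 167; 179; 192; 206; 221; 238; 257;
      278; 302; 329; 361; 397; 439; 488; 545; 612; 690; 781; 888; 1013;
      1159; 1329; 1528; 1760].

Definition algD_N (i : N) : bool :=
  has (N.eqb i) breaks || (2000 <=? i) && ((i - 2000) mod 40 =? 0).

Lemma mem_map_to_nat (i : nat) (s : seq N) :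
  (i \in map N.to_nat s) = has (N.eqb (N.of_nat i)) s.
Proof. by elim: s => //= x s <-; rewrite in_cons; congr orb; lia. Qed.

Lemma algD_NE (i : nat) : algD_N (N.of_nat i) = algD i.
Proof.
rewrite /algD_N -mem_map_to_nat /algD.
congr (_ || _); have -> : (2000 <=? N.of_nat i) = leq 2000 i by lia.
case: leqP => //= i_ge.
apply/N.eqb_spec/dvdnP => [/N.Lcm0.mod_divide[k ik]|[k ik]].
  by exists (N.to_nat k); lia.
by apply/N.Lcm0.mod_divide; exists (N.of_nat k); lia.
Qed.

(* [583 * cost <= 619 * ('C(n, 2) + c * n - 'C(c, 3))] multiplied by 6, without
   division or subtraction. *)
Definition within_ratio (c : N) (st : state) : bool :=
  let n := jobs st in
  3498 * current_cost st + 619 * (c * (c - 1) * (c - 2))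
    <=? 619 * (3 * n * (n - 1) + 6 * c * n).

Lemma small_within_ratio :
  all (fun st => within_ratio (threshold (jobs st)) st)
      (traject (step algD_N) (State 0 0 0 0) 2000).
Proof. by vm_compute. Qed.

Lemma run_2000 : run algD_N 2000 = State 2000 2000 48 2210760.
Proof. by vm_compute. Qed.

Lemma algD_N_tail (i : N) :
  2000 <= i -> algD_N i = ((i - 2000) mod 40 =? 0).
Proof. by move=> ?; rewrite /algD_N /=; lia. Qed.

(** After job 2000, the batch following [q] full ones costs [40 * (2089 + 41 * q)]; summing gives
    the quadratic in [q]. *)
Lemma run_tail (n : nat) : exists q r : N, r < 40 /\
  run algD_N (n + 2000) = State (2000 + 40 * q + r) (2000 + 40 * q) (48 + q)
                                (2210760 + 82740 * q + 820 * q * q).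
Proof.
elim: n => [|n [q [r [lt_r runE]]]]; first by exists 0, 0; rewrite run_2000.
have -> : run algD_N (n.+1 + 2000) = step algD_N (run algD_N (n + 2000)) by [].
rewrite runE /step /jobs algD_N_tail; last by lia.
have -> : 2000 + 40 * q + r + 1 - 2000 = r + 1 + q * 40 by lia.
rewrite N.Div0.mod_add.
have [->|r_lt] := N.eq_dec r 39.
  exists (q + 1), 0; split; first by lia.
  rewrite /next /current_cost.
  have -> : 2000 + 40 * q + 39 + 1 - (2000 + 40 * q) = 40 by lia.
  by congr State; lia.
exists q, (r + 1); split; first by lia.
rewrite N.mod_small; last by lia.
rewrite (_ : _ =? _ = false) /next; last by lia.
by congr State; lia.
Qed.

Lemma tail_within_ratio (n : nat) : within_ratio 64 (run algD_N (n + 2000)).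
Proof.
have [q [r [lt_r ->]]] := run_tail n.
rewrite /within_ratio /jobs /current_cost; apply/N.leb_spec0.
have -> : 2000 + 40 * q + r - (2000 + 40 * q) = r by lia.
have -> : 2000 + 40 * q + r - 1 = 1999 + 40 * q + r by lia.
(* The square of [r] has the larger coefficient on the left. Once its excess is made linear, the
   inequality holds coefficient by coefficient in [q] and [r]. *)
have : r * r <= 39 * r by apply: N.mul_le_mono_r; lia.
lia.
Qed.
End UpperBound.

Lemma within_ratioP (R : realType) (n : nat) (c : N) :
  within_ratio c (run algD_N n) ->
  cost 1 (fun=> 1) (@online_schedule algD n)
    <= 619 / 583 * @opt_cost R n 1 (fun=> 1).
Proof.
rewrite (cost_run (fun i _ => algD_NE i)) /within_ratio.
set x := current_cost _.
have -> : jobs (run algD_N n) = N.of_nat n.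
  by have [b [k [f [-> _]]]] := runP (fun i _ => algD_NE i) n.
move=> le_x; have := opt_cost_ge R n (N.to_nat c).
set d := N.to_nat c; set o := opt_cost _ _ => le_o.
have bin2E : ('C(n, 2) * 2 = n * (n - 1))%N.
  by rewrite (bin_ffact n 2) !ffactnS ffactn0 muln1 subn1.
have bin3E : ('C(d, 3) * 6 = d * (d - 1) * (d - 2))%N.
  by rewrite (bin_ffact d 3) !ffactnS ffactn0 muln1 subn1 subn2 mulnA.
have : (3498 * N.to_nat x + 619 * ('C(d, 3) * 6)
        <= 619 * (3 * ('C(n, 2) * 2) + 6 * d * n))%N.
  by rewrite bin2E bin3E; subst d; lia.
rewrite -(ler_nat R) !(natrD, natrM).
move: le_o; rewrite !(natrD, natrM); lra.
Qed.

Lemma algD_competitive (R : realType) : competitive (619 / 583 : R) algD.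
Proof.
move=> n; have [n_ge|n_lt] := leqP 2000 n.
  apply: (@within_ratioP R n 64); rewrite -(subnK n_ge).
  exact: tail_within_ratio.
apply: (@within_ratioP R n (threshold (jobs (run algD_N n)))).
have /(all_nthP (State 0 0 0 0))/(_ n) := small_within_ratio.
by rewrite size_traject nth_traject //; apply.
Qed.

Theorem theorem2 (R : realType) :
  competitive (619 / 583 : R) algD /\
  (forall C : R, C < 619 / 583 ->
     ~ exists S : online_algorithm, competitive C S).
Proof.
split; first exact: algD_competitive.
by move=> C ltC [S]; apply: not_competitive.
Qed.
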